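(* Let $(\mathcal A,\mathfrak g)$ be a (left) derivation based calculus and let $h$ be a left hermitian form (not assumed invertible) on $\Omega^1_{\mathfrak g}$. There exists a Levi-Civita connection on $\Omega^1_{\mathfrak g}$ with respect to $h$ if and only if there exists a regular connection $\nabla$ on $\Omega^1_{\mathfrak g}$ such that $$(T_h\circ s)(\nabla) = 2\,dh-T_h(d),$$ where $s$, $T_h$, $dh$ and $d$ (regarded as a map $\Omega^1_{\mathfrak g}\times\mathfrak g\to\Omega^1_{\mathfrak g}$) are as defined in the context.
   Context: Setting. $\mathcal A$ is a unital associative $*$-algebra over $\mathbb C$ with center $Z(\mathcal A)$. $\mathrm{Der}(\mathcal A)$ is the complex Lie algebra of derivations of $\mathcal A$, with $(z\partial)(a)=z\,\partial(a)$ for $z\in Z(\mathcal A)$ and $\partial^*(a)=\partial(a^* )^*$. $\mathfrak g\subseteq\mathrm{Der}(\mathcal A)$ is a complex Lie subalgebra closed under $*$ (not necessarily a $Z(\mathcal A)$-submodule). Forms. $\bar\Omega^k_{\mathfrak g}$ is the set of alternating multiadditive maps $\omega:\mathfrak g^k\to\mathcal A$ such that $\omega(z\partial,\partial_2,\dots,\partial_k)=z\,\omega(\partial,\partial_2,\dots,\partial_k)$ whenever $z\in Z(\mathcal A)$, $\partial\in\mathfrak g$ and $z\partial\in\mathfrak g$; $\bar\Omega^0_{\mathfrak g}=\mathcal A$. It is an $\mathcal A$-bimodule by $(a\omega b)(\cdot)=a\,\omega(\cdot)\,b$, with $*$-structure $\omega^*(\partial_1,\dots,\partial_k)=\omega(\partial_1^*,\dots,\partial_k^*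 )^*$. For $a\in\mathcal A$, $da(\partial)=\partial(a)$; for $\omega\in\bar\Omega^1_{\mathfrak g}$, $d\omega(\partial_0,\partial_1)=\partial_0\omega(\partial_1)-\partial_1\omega(\partial_0)-\omega([\partial_0,\partial_1])$. $\Omega^1_{\mathfrak g}\subseteq\bar\Omega^1_{\mathfrak g}$ is the sub-bimodule of finite sums of elements $a_0\,da_1$, $a_0,a_1\in\mathcal A$. Connections. A left $\mathfrak g$-connection on a left $\mathcal A$-module $M$ is a map $\nabla:M\times\mathfrak g\to M$, $(m,\partial)\mapsto\nabla_\partial m$, additive in both arguments, with $\nabla_\partial(am)=a\nabla_\partial m+(\partial a)m$ for $a\in\mathcal A$, and $\nabla_{z\partial}m=z\nabla_\partial m$ for $z\in Z(\mathcal A)$ with $z\partial\in\mathfrak g$. $(\mathcal A,\mathfrak g)$ is a (left) derivation based calculus if there exists a left $\mathfrak g$-connection on $\Omega^1_{\mathfrak g}$. Hermitian forms. A left hermitian form on a left $\mathcal A$-module $M$ is a map $h:M\times M\to\mathcal A$, additive in the first argument, with $h(am_1,m_2)=a\,h(m_1,m_2)$ and $h(m_1,m_2)^*=h(m_2,m_1)$. A connection $\nabla$ is compatible with $h$ if $\partial h(m_1,m_2)=h(\nabla_\partial m_1,m_2)+h(m_1,\nabla_{\partial^*}m_2)$ for all $m_1,m_2\in M$, $\partial\in\mathfrak g$. Levi-Civita. A connection $\nabla$ on $\Omega^1_{\mathfrak g}$ is torsion free if $(\nabla_{\partial_1}\omega)(\partial_2)-(\nabla_{\partial_2}\omega)(\partial_1)=d\omega(\partial_1,\partial_2)$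 for all $\omega\in\Omega^1_{\mathfrak g}$, $\partial_1,\partial_2\in\mathfrak g$. It is a Levi-Civita connection with respect to $h$ if it is torsion free and compatible with $h$. Operators. Consider biadditive maps $\alpha:\Omega^1_{\mathfrak g}\times\mathfrak g\to\Omega^1_{\mathfrak g}$ that are $\mathbb C$-linear in the first argument and satisfy $\alpha(\omega,z\partial)=z\alpha(\omega,\partial)$ whenever $z\in Z(\mathcal A)$ and $z\partial\in\mathfrak g$ (connections are such maps, via $\nabla(\omega,\partial)=\nabla_\partial\omega$). Put $\sigma(\alpha)(\omega,\partial)(\partial')=\alpha(\omega,\partial')(\partial)$, so $\sigma(\alpha)(\omega,\partial)\in\bar\Omega^1_{\mathfrak g}$. $\alpha$ is called regular if $\sigma(\alpha)(\omega,\partial)\in\Omega^1_{\mathfrak g}$ for all $\omega\in\Omega^1_{\mathfrak g},\partial\in\mathfrak g$. A regular connection is a left $\mathfrak g$-connection on $\Omega^1_{\mathfrak g}$ that is regular. Put $s(\alpha)=\alpha+\sigma(\alpha)$; if $\alpha$ is regular, then $s(\alpha)$ again takes values in $\Omega^1_{\mathfrak g}$. The exterior derivative is regarded as a map $\Omega^1_{\mathfrak g}\times\mathfrak g\to\Omega^1_{\mathfrak g}$ of this kind by $d(\omega,\partial_1)(\partial_2)=d\omega(\partial_1,\partial_2)$. For any biadditive map $\alpha:\Omega^1_{\mathfrak g}\times\mathfrak g\to\Omega^1_{\mathfrak g}$ that is $\mathbb C$-linear in the first argument and satisfies $\alpha(\omega,z\partial)=z\alpha(\omega,\partial)$ whenever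 $z\in Z(\mathcal A)$ and $z\partial\in\mathfrak g$, put $h_\alpha(\omega,\eta)(\partial)=h(\alpha(\omega,\partial),\eta)$, so $h_\alpha(\omega,\eta)\in\bar\Omega^1_{\mathfrak g}$; for $L:\Omega^1_{\mathfrak g}\times\Omega^1_{\mathfrak g}\to\bar\Omega^1_{\mathfrak g}$ put $L^*(\omega,\eta)=L(\eta,\omega)^*$. Define $T_h(\alpha)=h_\alpha+h_\alpha^*$, and $dh(\omega,\eta)=d(h(\omega,\eta))$, i.e. $dh(\omega,\eta)(\partial)=\partial h(\omega,\eta)$. *)

(* Defs.v *)
From HB Require Import structures.
From mathcomp Require Import all_boot all_order all_algebra.
From mathcomp Require Import complex.
From mathcomp Require Import boolp functions reals.

Set Implicit Arguments.
Unset Strict Implicit.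
Unset Printing Implicit Defensive.

Import GRing.Theory Num.Theory.
Local Open Scope ring_scope.

(* Unital associative *-algebras over C.  [GRing.Algebra] requires [1 != 0] and
   would exclude the zero algebra, so the scalars are given by the structure
   morphism from C to the center of A: c . a is [cscal c * a]. *)
HB.mixin Record isStarAlgebra (C : numClosedFieldType) A of GRing.PzRing A := {
  cscal : {rmorphism C -> A};
  cscalC : forall (c : C) (a : A), cscal c * a = a * cscal c;
  star : A -> A;
  starD : {morph star : a b / a + b};
  starZ : forall (c : C) (a : A), star (cscal c * a) = cscal (c^*) * star a;
  starM : forall a b : A, star (a * b) = star b * star a;
  starK : involutive star
}.

#[short(type="starAlgType")]
HB.structure Definition StarAlgebra (C : numClosedFieldType) :=
  {A of GRing.PzRing A & isStarAlgebra C A}.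

Section Derivations.
Variables (C : numClosedFieldType) (A : starAlgType C).
Implicit Types (a b z : A) (D E : A -> A).

Definition central z := forall a, a * z = z * a.

Definition derivation D :=
  [/\ {morph D : a b / a + b},
      forall (c : C) a, D (cscal c * a) = cscal c * D a &
      forall a b, D (a * b) = D a * b + a * D b].

Definition der_scale z D : A -> A := fun a => z * D a.
Definition der_star D : A -> A := fun a => star (D (star a)).
Definition der_bracket D E : A -> A := fun a => D (E a) - E (D a).

Record starLieSubalgebra := StarLieSubalgebra {
  lie_pred :> {pred A -> A};
  lie_derivation : forall D, D \in lie_pred -> derivation D;
  lie_zmod : zmod_closed lie_pred;
  lie_scale_closed : forall (c : C) D,
    D \in lie_pred -> der_scale (cscal c) D \in lie_pred;
  lie_bracket_closed : forall D E,
    D \in lie_pred -> E \in lie_pred -> der_bracket D E \in lie_pred;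
  lie_star_closed : forall D, D \in lie_pred -> der_star D \in lie_pred
}.

Lemma star0 : star (0 : A) = 0.
Proof. by apply: (@addrI _ (star 0)); rewrite -starD !addr0. Qed.

Lemma star1 : star (1 : A) = 1.
Proof. by rewrite -[LHS]mul1r -{1}[1 : A]starK -starM mul1r starK. Qed.

Lemma starN a : star (- a) = - star a.
Proof. by apply: (@addrI _ (star a)); rewrite -starD !subrr star0. Qed.

Lemma central_star z : central z -> central (star z).
Proof. by move=> zZ a; rewrite -{1}[a]starK -starM -zZ starM starK. Qed.

End Derivations.

HB.instance Definition _ (C : numClosedFieldType) (A : starAlgType C)
    (g : starLieSubalgebra A) :=
  GRing.isZmodClosed.Build (A -> A) (lie_pred g) (lie_zmod g).

Section LieElements.
Variables (C : numClosedFieldType) (A : starAlgType C).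
Variable g : starLieSubalgebra A.

Record lie_elt := LieElt { lie_val :> A -> A; lie_valP : lie_val \in lie_pred g }.

HB.instance Definition _ := [isSub for lie_val].
HB.instance Definition _ := [Choice of lie_elt by <:].
HB.instance Definition _ := [SubChoice_isSubZmodule of lie_elt by <:].

Implicit Types D E : lie_elt.

Definition lie_star D : lie_elt := LieElt (lie_star_closed (lie_valP D)).
Definition lie_bracket D E : lie_elt :=
  LieElt (lie_bracket_closed (lie_valP D) (lie_valP E)).

(* [f (z D) = z f(D)] whenever [z D] happens to lie in [g], which is not assumed
   to be stable under multiplication by the center. *)
Definition Zhomogeneous (V : lmodType A) (f : lie_elt -> V) :=
  forall (z : A) D (zDg : der_scale z D \in lie_pred g),
    central z -> f (LieElt zDg) = z *: f D.

Lemma lie_addE D E a : (D + E) a = D a + E a. Proof. by []. Qed.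

Lemma lieD D a b : D (a + b) = D a + D b.
Proof. by have [-> _ _] := lie_derivation (lie_valP D). Qed.

Lemma lie0 D : D 0 = 0.
Proof. by apply: (@addrI _ (D 0)); rewrite -lieD !addr0. Qed.

Lemma lieZ D (c : C) a : D (cscal c * a) = cscal c * D a.
Proof. by have [_ -> _] := lie_derivation (lie_valP D). Qed.

Lemma lieN D a : D (- a) = - D a.
Proof. by apply: (@addrI _ (D a)); rewrite -lieD !subrr lie0. Qed.

Lemma lieM D a b : D (a * b) = D a * b + a * D b.
Proof. by have [_ _ ->] := lie_derivation (lie_valP D). Qed.

Lemma lie1 D : D 1 = 0.
Proof.
by apply: (@addrI _ (D 1)); rewrite addr0 -{3}[1 : A]mulr1 lieM mulr1 mul1r.
Qed.

Lemma lie_starD : {morph lie_star : D E / D + E}.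
Proof.
by move=> D E; apply: val_inj; apply/funext => a; rewrite /= /der_star starD.
Qed.

End LieElements.

Section Forms.
Variables (C : numClosedFieldType) (A : starAlgType C).
Variable g : starLieSubalgebra A.
Notation gT := (lie_elt g).

(* For 1-forms the alternating condition is void.  The regular module [A^o]
   makes [gT -> A^o] a left A-module by [(a *: w) D = a * w D]. *)
Definition barOmega1_pred : {pred gT -> A^o} :=
  fun w => `[< {morph w : D E / D + E} /\ Zhomogeneous w >].

Lemma barOmega1_submod : subsemimod_closed barOmega1_pred.
Proof.
split; [split|] => [|v w|a v].
- by apply/asboolP; split=> [D E|z D zD zZ] /=; rewrite ?addr0 ?scaler0.
- move=> /asboolP[vD vZ] /asboolP[wD wZ]; apply/asboolP; split=> [D E|z D zD zZ].
  + by rewrite !addrfctE vD wD addrACA.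
  + by rewrite !addrfctE vZ // wZ // scalerDr.
- move=> /asboolP[vD vZ]; apply/asboolP; split=> [D E|z D zD zZ].
  + by rewrite !scalrfctE vD scalerDr.
  + by rewrite !scalrfctE vZ // !scalerA zZ.
Qed.

HB.instance Definition _ :=
  GRing.isSubmodClosed.Build A (gT -> A^o) barOmega1_pred barOmega1_submod.

Record barOmega1 := BarOmega1 {
  bar_val :> gT -> A^o;
  bar_valP : bar_val \in barOmega1_pred
}.

HB.instance Definition _ := [isSub for bar_val].
HB.instance Definition _ := [Choice of barOmega1 by <:].
HB.instance Definition _ := [SubChoice_isSubLmodule of barOmega1 by <:].

Implicit Types (a b : A) (D E : gT) (w v : barOmega1).

Lemma barP w v : (forall D, w D = v D) -> w = v.
Proof. by move=> wv; apply: val_inj; apply/funext. Qed.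

Lemma bar_addE w v D : (w + v) D = w D + v D. Proof. by []. Qed.
Lemma bar_oppE w D : (- w) D = - w D. Proof. by []. Qed.
Lemma bar_scaleE (a : A) w D : (a *: w) D = a * w D. Proof. by []. Qed.
Definition barE := (bar_addE, bar_oppE, bar_scaleE).

Lemma barD w D E : w (D + E) = w D + w E.
Proof. by have /asboolP[-> _] := bar_valP w. Qed.

Lemma barZ w : Zhomogeneous w.
Proof. by have /asboolP[_] := bar_valP w. Qed.

Lemma bar_right_subproof w (b : A) : (fun D => w D * b : A^o) \in barOmega1_pred.
Proof.
apply/asboolP; split=> [D E|z D zD zZ]; first by rewrite barD mulrDl.
by rewrite barZ // /GRing.scale /= mulrA.
Qed.

Definition bar_right w (b : A) : barOmega1 := BarOmega1 (bar_right_subproof w b).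

Lemma bar_rightE w b D : bar_right w b D = w D * b. Proof. by []. Qed.

Lemma bar_star_subproof w :
  (fun D => star (w (lie_star D)) : A^o) \in barOmega1_pred.
Proof.
apply/asboolP; split=> [D E|z D zD zZ]; first by rewrite lie_starD barD starD.
have zD' : der_scale (star z) (lie_star D) \in lie_pred g.
  suff -> : der_scale (star z) (lie_star D) = lie_star (LieElt zD).
    exact: lie_valP.
  by apply/funext=> a; rewrite /der_scale /= /der_star starM (central_star zZ).
have -> : lie_star (LieElt zD) = LieElt zD'.
  by apply: val_inj; apply/funext=> a;
     rewrite /= /der_scale /= /der_star starM (central_star zZ).
rewrite barZ; last exact: central_star.
by rewrite /GRing.scale /= starM starK zZ.
Qed.

Definition bar_star w : barOmega1 := BarOmega1 (bar_star_subproof w).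

Lemma dform0_subproof (a : A) : (fun D => D a : A^o) \in barOmega1_pred.
Proof. by apply/asboolP; split. Qed.

Definition dform0 (a : A) : barOmega1 := BarOmega1 (dform0_subproof a).

Definition dform1 w D E : A := D (w E) - E (w D) - w (lie_bracket D E).

Definition Omega1_pred : {pred barOmega1} :=
  fun w => `[< exists s : seq (A * A), w = \sum_(p <- s) p.1 *: dform0 p.2 >].

Lemma Omega1_submod : subsemimod_closed Omega1_pred.
Proof.
split; [split|] => [|v w|a v].
- by apply/asboolP; exists [::]; rewrite big_nil.
- move=> /asboolP[s ->] /asboolP[t ->]; apply/asboolP.
  by exists (s ++ t); rewrite big_cat.
- move=> /asboolP[s ->]; apply/asboolP.
  exists [seq (a * p.1, p.2) | p <- s].
  by rewrite big_map scaler_sumr; apply: eq_bigr => p _; rewrite scalerA.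
Qed.

HB.instance Definition _ :=
  GRing.isSubmodClosed.Build A barOmega1 Omega1_pred Omega1_submod.

Record Omega1 := MkOmega1 {
  Omega1_val :> barOmega1;
  Omega1_valP : Omega1_val \in Omega1_pred
}.

HB.instance Definition _ := [isSub for Omega1_val].
HB.instance Definition _ := [Choice of Omega1 by <:].
HB.instance Definition _ := [SubChoice_isSubLmodule of Omega1 by <:].

Lemma Omega1P (w v : Omega1) : (forall D, w D = v D) -> w = v.
Proof. by move=> wv; apply: val_inj; apply: barP. Qed.

Lemma Omega1_ind (P : barOmega1 -> Prop) :
    P 0 -> (forall a b w, P w -> P (a *: dform0 b + w)) ->
  forall w, w \in Omega1_pred -> P w.
Proof.
move=> P0 PD w /asboolP[s ->]; elim: s => [|p s IHs]; first by rewrite big_nil.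
by rewrite big_cons; apply: PD.
Qed.

Lemma dform0_Omega1 a : dform0 a \in Omega1_pred.
Proof. by apply/asboolP; exists [:: (1, a)]; rewrite big_seq1 scale1r. Qed.

Lemma Omega1_right w b : w \in Omega1_pred -> bar_right w b \in Omega1_pred.
Proof.
move: w; apply: Omega1_ind => [|a c w IHw].
  suff -> : bar_right 0 b = 0 by apply: rpred0.
  by apply: barP => D /=; rewrite mul0r.
have -> : bar_right (a *: dform0 c + w) b =
    a *: dform0 (c * b) - (a * c) *: dform0 b + bar_right w b.
  apply: barP => D; rewrite bar_rightE !barE /= lieM mulrDl; congr (_ + _).
  by rewrite mulrDr !mulrA addrK.
by rewrite rpredD // rpredB // rpredZ // dform0_Omega1.
Qed.

Lemma dform1_gen a b w D E :
  dform1 (a *: dform0 b + w) D E = D a * E b - E a * D b + dform1 w D E.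
Proof.
rewrite /dform1 !barE /= /der_bracket.
rewrite !lieD !lieM mulrBr !opprD !opprK.
rewrite [LHS](AC (3*3*3) ((1*4)*(3*6*9)*((2*7)*(5*8)))) /=.
by rewrite subrr addNr !addr0.
Qed.

Lemma dform1_0 D E : dform1 0 D E = 0.
Proof. by rewrite /dform1 /= !lie0 !subr0. Qed.

Lemma dform1_Omega1 w D : w \in Omega1_pred ->
  exists2 v, v \in Omega1_pred & forall E, v E = dform1 w D E.
Proof.
move: w; apply: Omega1_ind => [|a b w [v vO vE]].
  by exists 0; [exact: rpred0 | move=> E; rewrite dform1_0].
exists (D a *: dform0 b - bar_right (dform0 a) (D b) + v).
  by rewrite rpredD // rpredB // ?rpredZ ?Omega1_right // dform0_Omega1.
by move=> E; rewrite dform1_gen !barE vE.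
Qed.

Lemma dform1Dl w v D E : dform1 (w + v) D E = dform1 w D E + dform1 v D E.
Proof.
rewrite /dform1 !barE !lieD !opprD.
by rewrite [LHS](AC (2*2*2) ((1*3*5)*(2*4*6))).
Qed.

Lemma dform1Zl (c : C) w D E :
  dform1 ((cscal c : A) *: w) D E = cscal c * dform1 w D E.
Proof. by rewrite /dform1 !barE !lieZ !mulrBr. Qed.

Lemma dform1Dr w D E F : w \in Omega1_pred ->
  dform1 w (D + E) F = dform1 w D F + dform1 w E F.
Proof.
move: w; apply: Omega1_ind => [|a b w IHw]; first by rewrite !dform1_0 addr0.
rewrite !dform1_gen IHw /= mulrDl mulrDr opprD.
by rewrite [LHS](AC (2*2*2) ((1*3*5)*(2*4*6))).
Qed.

Lemma dform1Z w z D (zD : der_scale z D \in lie_pred g) E :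
  w \in Omega1_pred -> central z -> dform1 w (LieElt zD) E = z * dform1 w D E.
Proof.
move=> wO zZ; move: w wO.
apply: Omega1_ind => [|a b w IHw]; first by rewrite !dform1_0 mulr0.
rewrite !dform1_gen IHw [RHS]mulrDr /= /der_scale; congr (_ + _).
by rewrite mulrBr !mulrA zZ.
Qed.

End Forms.

Arguments barOmega1_pred {C A} g _.
Arguments Omega1_pred {C A} g _.

Section Connections.
Variables (C : numClosedFieldType) (A : starAlgType C).
Variable g : starLieSubalgebra A.
Notation gT := (lie_elt g).

Record connection (M : lmodType A) := Connection {
  nabla :> M -> gT -> M;
  nablaDl : forall m n D, nabla (m + n) D = nabla m D + nabla n D;
  nablaDr : forall m D E, nabla m (D + E) = nabla m D + nabla m E;
  nablaM : forall (a : A) m D, nabla (a *: m) D = a *: nabla m D + D a *: m;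
  nablaZ : forall m, Zhomogeneous (nabla m)
}.

Record hermitian_form (M : lmodType A) := HermitianForm {
  herm :> M -> M -> A;
  hermDl : forall m n p, herm (m + n) p = herm m p + herm n p;
  hermZl : forall (a : A) m n, herm (a *: m) n = a * herm m n;
  herm_star : forall m n, star (herm m n) = herm n m
}.

Definition compatible (M : lmodType A) (h : hermitian_form M)
    (N : connection M) : Prop :=
  forall m n (D : gT), D (h m n) = h (N m D) n + h m (N n (lie_star D)).

Definition derivation_based_calculus : Prop :=
  inhabited (connection (Omega1 g)).

Definition torsion_free (N : connection (Omega1 g)) : Prop :=
  forall w D E, N w D E - N w E D = dform1 w D E.

Definition levi_civita (h : hermitian_form (Omega1 g))
    (N : connection (Omega1 g)) : Prop :=
  torsion_free N /\ compatible h N.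

End Connections.

Section Operators.
Variables (C : numClosedFieldType) (A : starAlgType C).
Variable g : starLieSubalgebra A.
Notation gT := (lie_elt g).
Notation Om := (Omega1 g).

Record operator := Operator {
  op_fun :> Om -> gT -> Om;
  opDl : forall w v D, op_fun (w + v) D = op_fun w D + op_fun v D;
  opDr : forall w D E, op_fun w (D + E) = op_fun w D + op_fun w E;
  op_linear : forall (c : C) w D,
    op_fun ((cscal c : A) *: w) D = (cscal c : A) *: op_fun w D;
  opZ : forall w, Zhomogeneous (op_fun w)
}.

Lemma connection_linear (N : connection g Om) (c : C) w D :
  N ((cscal c : A) *: w) D = (cscal c : A) *: N w D.
Proof.
have Dc : D (cscal c) = 0 by rewrite -[cscal c]mulr1 lieZ lie1 mulr0.
by rewrite nablaM Dc scale0r addr0.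
Qed.

Definition operator_of_connection (N : connection g Om) : operator :=
  Operator (nablaDl N) (nablaDr N) (connection_linear N) (nablaZ N).

Implicit Types (al : operator) (w v : Om) (D E : gT).

Lemma sigma_subproof al w D :
  (fun E => al w E D : A^o) \in barOmega1_pred g.
Proof.
apply/asboolP; split=> [E F|z E zE zZ]; first by rewrite opDr.
by rewrite opZ.
Qed.

Definition sigma al w D : barOmega1 g := BarOmega1 (sigma_subproof al w D).

Definition regular al : Prop := forall w D, sigma al w D \in Omega1_pred g.

Lemma sigmaE al w D E : sigma al w D E = al w E D. Proof. by []. Qed.

Section Symmetrization.
Variables (al : operator) (al_reg : regular al).

(* [s al = al + sigma al], with values in [Omega1] because [al] is regular. *)
Definition symm_fun w D : Om := al w D + MkOmega1 (al_reg w D).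

Lemma symm_funE w D E : symm_fun w D E = al w D E + al w E D.
Proof. by []. Qed.

Lemma symmDl w v D : symm_fun (w + v) D = symm_fun w D + symm_fun v D.
Proof.
apply: Omega1P => E; rewrite symm_funE !opDl.
by rewrite [RHS]bar_addE !symm_funE !bar_addE addrACA.
Qed.

Lemma symmDr w D E : symm_fun w (D + E) = symm_fun w D + symm_fun w E.
Proof.
apply: Omega1P => F; rewrite symm_funE opDr barD.
by rewrite [RHS]bar_addE !symm_funE !bar_addE addrACA.
Qed.

Lemma symm_linear (c : C) w D :
  symm_fun ((cscal c : A) *: w) D = (cscal c : A) *: symm_fun w D.
Proof.
apply: Omega1P => E; rewrite symm_funE !op_linear.
by rewrite [RHS]bar_scaleE symm_funE !bar_scaleE mulrDr.
Qed.

Lemma symmZ w : Zhomogeneous (symm_fun w).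
Proof.
move=> z D zD zZ; apply: Omega1P => E; rewrite symm_funE opZ // barZ //.
by rewrite [RHS]bar_scaleE symm_funE !bar_scaleE mulrDr.
Qed.

Definition symm : operator := Operator symmDl symmDr symm_linear symmZ.

End Symmetrization.

Lemma d_form_subproof w D : (fun E => dform1 w D E : A^o) \in barOmega1_pred g.
Proof.
have [v _ vE] := dform1_Omega1 D (Omega1_valP w).
by rewrite (_ : (fun _ => _) = v); [exact: bar_valP | apply/funext].
Qed.

(* The exterior derivative as a map [w, D |-> (E |-> dw(D, E))]; it takes values
   in [Omega1] since d(a db)(D, _) = D(a) db - da D(b). *)
Definition d_form w D : barOmega1 g := BarOmega1 (d_form_subproof w D).

Lemma d_fun_subproof w D : d_form w D \in Omega1_pred g.
Proof.
have [v vO vE] := dform1_Omega1 D (Omega1_valP w).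
by rewrite (_ : d_form w D = v) //; apply: barP.
Qed.

Definition d_fun w D : Om := MkOmega1 (d_fun_subproof w D).

Lemma d_funE w D E : d_fun w D E = dform1 w D E. Proof. by []. Qed.

Lemma d_funDl w v D : d_fun (w + v) D = d_fun w D + d_fun v D.
Proof. by apply: Omega1P => E; rewrite d_funE dform1Dl. Qed.

Lemma d_funDr w D E : d_fun w (D + E) = d_fun w D + d_fun w E.
Proof.
by apply: Omega1P => F; rewrite d_funE (dform1Dr _ _ _ (Omega1_valP w)).
Qed.

Lemma d_fun_linear (c : C) w D :
  d_fun ((cscal c : A) *: w) D = (cscal c : A) *: d_fun w D.
Proof. by apply: Omega1P => E; rewrite d_funE dform1Zl. Qed.

Lemma d_funZ w : Zhomogeneous (d_fun w).
Proof.
move=> z D zD zZ; apply: Omega1P => E.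
by rewrite d_funE (dform1Z zD E (Omega1_valP w) zZ).
Qed.

Definition d_op : operator := Operator d_funDl d_funDr d_fun_linear d_funZ.

Variable h : hermitian_form Om.

Lemma h_op_subproof al w v : (fun D => h (al w D) v : A^o) \in barOmega1_pred g.
Proof.
apply/asboolP; split=> [D E|z D zD zZ]; first by rewrite opDr hermDl.
by rewrite opZ // hermZl.
Qed.

Definition h_op al w v : barOmega1 g := BarOmega1 (h_op_subproof al w v).

Definition form_adj (L : Om -> Om -> barOmega1 g) : Om -> Om -> barOmega1 g :=
  fun w v => bar_star (L v w).

Definition T_op al : Om -> Om -> barOmega1 g := h_op al + form_adj (h_op al).

Definition dh : Om -> Om -> barOmega1 g := fun w v => dform0 g (h w v).

End Operators.

(* Main.v *)
(** If [N] is torsion free then [sigma N = N - d], so [N] is regular and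
    [s N + d = 2 N].  Conversely, for any regular connection [N] the map
    [(s N + d) / 2] is a torsion-free connection: the terms [E a * w D] which
    spoil the Leibniz rule cancel between [s N] and [d].  In both directions
    there is a connection [N'] with [2 N' = s N + d], and since
    [T_h N' = dh] expresses compatibility, additivity of [T_h] turns the
    equation for [N] into compatibility of [N']. *)
Require Import Defs.
From HB Require Import structures.
From mathcomp Require Import all_boot all_order all_algebra.
From mathcomp Require Import complex.
From mathcomp Require Import boolp functions reals.

Import GRing.Theory Num.Theory.
Local Open Scope ring_scope.

Section LeviCivita.
Variables (C : numClosedFieldType) (A : starAlgType C).
Variable g : starLieSubalgebra A.
Notation gT := (lie_elt g).
Notation Om := (Omega1 g).
Implicit Types (a b : A) (w v : Om) (D E : gT) (N : connection g Om).

Let half : A := cscal (2^-1 : C).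

Lemma cscal_halfD : half + half = 1.
Proof. by rewrite /half -rmorphD -[_ + _]mul1r mulrDr -splitr rmorph1. Qed.

Lemma cscal_half_comm a : half * a = a * half.
Proof. exact: cscalC. Qed.

Lemma scale_halfD (M : lmodType A) (m : M) : half *: m + half *: m = m.
Proof. by rewrite -scalerDl cscal_halfD scale1r. Qed.

(** Multiplying by the scalar [half] undoes doubling. *)
Lemma star_alg_mulr2_inj : injective (fun a => a *+ 2).
Proof.
move=> a b /= ab; rewrite -[a]mul1r -[b]mul1r -cscal_halfD.
by rewrite !mulrDl -!mulrDr -!mulr2n ab.
Qed.

Lemma Omega1_addE w v D : (w + v) D = w D + v D. Proof. by []. Qed.
Lemma Omega1_scaleE a w D : (a *: w) D = a * w D. Proof. by []. Qed.

Lemma dform1_antisym (w : barOmega1 g) D E : dform1 w E D = - dform1 w D E.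
Proof.
(* Only the bracket term needs an argument: [[E, D] = - [D, E]], and [w] is additive. *)
have -> : dform1 w E D = E (w D) - D (w E) - w (- lie_bracket D E).
  rewrite /dform1; congr (_ - w _); apply: val_inj; apply/funext => a.
  by rewrite /= /der_bracket [RHS]opprB.
have w0 : w 0 = 0 by apply: (@addrI _ (w 0)); rewrite -barD !addr0.
have -> F : w (- F) = - w F.
  by apply: (@addrI _ (w F)); rewrite -barD !subrr w0.
by rewrite /dform1 !opprB opprK addrC.
Qed.

(** The last two terms are the wedge product of [da] and [w]; the one with [E a] is the correction
    that [tf_M] relies on. *)
Lemma dform1Ml a (w : barOmega1 g) D E :
  dform1 (a *: w) D E = a * dform1 w D E + D a * w E - E a * w D.
Proof.
rewrite /dform1 !barE !lieM !mulrBr !opprD.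
by rewrite [LHS](AC (2*2*1) ((2*4*5)*1*3)).
Qed.

Lemma torsion_free_sigma N w D :
  torsion_free N -> sigma (operator_of_connection N) w D = N w D - d_fun w D.
Proof.
by move=> Ntf; apply: barP => E; rewrite bar_addE bar_oppE d_funE -Ntf subKr.
Qed.

Lemma torsion_free_regular N :
  torsion_free N -> regular (operator_of_connection N).
Proof.
by move=> Ntf w D; rewrite torsion_free_sigma // rpredB // Omega1_valP.
Qed.

Lemma symmE (al : operator g) (al_reg : regular al) w D E :
  symm al_reg w D E = al w D E + al w E D.
Proof. by []. Qed.

Lemma torsion_free_symm N (N_reg : regular (operator_of_connection N)) w D :
  torsion_free N -> N w D *+ 2 = symm N_reg w D + d_fun w D.
Proof.
move=> Ntf; apply: Omega1P => E.
rewrite mulr2n [LHS]Omega1_addE [RHS]Omega1_addE symmE d_funE -Ntf.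
by rewrite -addrA [N w E D + _]addrC subrK.
Qed.

Section TorsionFreePart.
Variables (N : connection g Om) (N_reg : regular (operator_of_connection N)).

Let tf_fun w D : Om := half *: (symm N_reg w D + d_fun w D).

Let tf_funE w D E : tf_fun w D E = half * (N w D E + N w E D + dform1 w D E).
Proof. by []. Qed.

Let tf_Dl w v D : tf_fun (w + v) D = tf_fun w D + tf_fun v D.
Proof. by rewrite /tf_fun opDl d_funDl addrACA scalerDr. Qed.

Let tf_Dr w D E : tf_fun w (D + E) = tf_fun w D + tf_fun w E.
Proof. by rewrite /tf_fun opDr d_funDr addrACA scalerDr. Qed.

Let tf_M a w D : tf_fun (a *: w) D = a *: tf_fun w D + D a *: w.
Proof.
(* Splitting [D a *: w] into two halves lets [half] be factored out of both sides. *)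
rewrite -[D a *: w]scale_halfD; apply: Omega1P => E.
rewrite [RHS]Omega1_addE [X in _ = X + _]Omega1_scaleE !tf_funE !nablaM.
rewrite !Omega1_addE !Omega1_scaleE dform1Ml.
rewrite [a * (half * _)]mulrA -cscal_half_comm -!mulrA -!mulrDr; congr (_ * _).
(* Grouped as: the multiples of [a]; the two copies of [D a * w E], one from [N] and one from [d];
   the terms [E a * w D] from [sigma N] and from [d], which cancel. *)
rewrite !mulrDr [LHS](AC (2*2*3) ((1*3*5)*(2*6)*(4*7))) /=.
by rewrite subrr addr0.
Qed.

Let tf_Z w : Zhomogeneous (tf_fun w).
Proof.
move=> z D zD zZ; rewrite /tf_fun opZ // d_funZ // -scalerDr !scalerA.
by rewrite cscal_half_comm.
Qed.

Definition torsion_free_part : connection g Om :=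
  Connection tf_Dl tf_Dr tf_M tf_Z.

Lemma torsion_free_partE w D :
  torsion_free_part w D *+ 2 = symm N_reg w D + d_fun w D.
Proof. by rewrite mulr2n scale_halfD. Qed.

Lemma torsion_free_part_val w D E :
  torsion_free_part w D E = half * (N w D E + N w E D + dform1 w D E).
Proof. by []. Qed.

(** Exchanging [D] and [E] fixes the symmetrized part and negates [dform1], so the difference is
    [dform1] counted twice and halved. *)
Lemma torsion_free_partP : torsion_free torsion_free_part.
Proof.
move=> w D E; rewrite !torsion_free_part_val (dform1_antisym w D E) -mulrBr.
rewrite [N w E D + N w D E]addrC opprB.
rewrite [_ + dform1 w D E]addrC addrACA subrr addr0.
by rewrite mulrDr -mulrDl cscal_halfD mul1r.
Qed.

End TorsionFreePart.

Variable h : hermitian_form Om.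

(** Hermitian symmetry of [h] absorbs the outer star of [form_adj], leaving the right-hand side of
    metric compatibility. *)
Lemma T_opE (al : operator g) w v D :
  T_op h al w v D = h (al w D) v + h w (al v (lie_star D)).
Proof. by rewrite -(herm_star h _ w). Qed.

Lemma compatibleE N :
  compatible h N <-> T_op h (operator_of_connection N) = dh h.
Proof.
split=> [Nh|Nh w v D]; last first.
  by rewrite -[RHS](T_opE (operator_of_connection N)) Nh.
by apply/funext => w; apply/funext => v; apply: barP => D; rewrite T_opE -Nh.
Qed.

(** Additivity of T_h in pointwise form, since the type [operator] is given no addition. *)
Lemma T_op_mulr2 (al be ga : operator g) :
    (forall w D, al w D *+ 2 = be w D + ga w D) ->
  T_op h al *+ 2 = T_op h be + T_op h ga.
Proof.
move=> alE; apply/funext => w; apply/funext => v; apply: barP => D.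
have hE x D' y : h (al x D') y *+ 2 = h (be x D') y + h (ga x D') y.
  by rewrite mulr2n -!hermDl -mulr2n alE.
rewrite mulr2n !addrfctE !bar_addE /= -mulr2n mulrnDl hE.
by rewrite mulr2n -starD -mulr2n hE starD addrACA.
Qed.

(** [N'] is kept general to serve both directions: it becomes [N] itself when [N] is torsion free,
    and [torsion_free_part N N_reg] otherwise. *)
Lemma compatible_symm N (N_reg : regular (operator_of_connection N)) N' :
    (forall w D, N' w D *+ 2 = symm N_reg w D + d_fun w D) ->
  compatible h N' <-> T_op h (symm N_reg) = dh h *+ 2 - T_op h (d_op g).
Proof.
move=> N'E; have T2 : T_op h (operator_of_connection N') *+ 2 =
    T_op h (symm N_reg) + T_op h (d_op g) by exact: T_op_mulr2.
split=> [/compatibleE<-|sE]; first by rewrite T2 addrK.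
apply/compatibleE; move: T2; rewrite sE subrK => T2.
apply/funext => w; apply/funext => v; apply: barP => D.
(* The factor 2 is cancelled on values in [A]. *)
apply: star_alg_mulr2_inj.
exact: (congr1 (fun L : Om -> Om -> barOmega1 g => L w v D) T2).
Qed.

Lemma levi_civita_regularE :
  (exists N, levi_civita h N) <->
  (exists N (N_reg : regular (operator_of_connection N)),
     T_op h (symm N_reg) = dh h *+ 2 - T_op h (d_op g)).
Proof.
split=> [[N [Ntf Nh]]|[N [N_reg NE]]].
  exists N, (torsion_free_regular N Ntf).
  by apply/(compatible_symm N _ N) => // w D; apply: torsion_free_symm.
exists (torsion_free_part N N_reg); split; first exact: torsion_free_partP.
by apply/(compatible_symm N N_reg) => // w D; apply: torsion_free_partE.
Qed.

End LeviCivita.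

Theorem corollary7p3 (R : realType) (A : starAlgType R[i])
    (g : starLieSubalgebra A) (h : hermitian_form (Omega1 g)) :
  derivation_based_calculus g ->
  (exists N : connection g (Omega1 g), levi_civita h N)
  <->
  (exists (N : connection g (Omega1 g))
          (N_reg : regular (operator_of_connection N)),
     T_op h (symm N_reg) = dh h *+ 2 - T_op h (d_op g)).
Proof. by move=> _; apply: levi_civita_regularE. Qed.
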